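(* Let $k=n-2\ge 2$. A subgroup $G\le S_n$ fails to be Galois closed over $\mathbf{k}$ if and only if one of the following holds: (i) $G=A_n$; (ii) $G$ is the alternating group $A_{B}$ on some subset $B\subseteq\mathbf{n}$ with $|B|=n-1$ (regarded as a subgroup of $S_n$ fixing the remaining point); (iii) $n=4$ and $G$ is a cyclic group of order $4$ generated by a $4$-cycle.
   Context: For a positive integer $m$ put $\mathbf{m}=\{1,\dots,m\}$. $S_n$ and $A_n$ are the symmetric and alternating groups on $\mathbf{n}$. A permutation $\sigma\in S_n$ (written $i\mapsto i\sigma$) leaves an operation $f\colon\mathbf{k}^n\to\mathbf{k}$ invariant if $f(x_1,\dots,x_n)=f(x_{1\sigma},\dots,x_{n\sigma})$ for all $(x_1,\dots,x_n)\in\mathbf{k}^n$. For $G\le S_n$, the Galois closure $\overline{G}^{(k)}$ of $G$ over $\mathbf{k}$ is the subgroup of $S_n$ consisting of all $\sigma\in S_n$ such that every $f\colon\mathbf{k}^n\to\mathbf{k}$ that is invariant under all elements of $G$ is also invariant under $\sigma$. $G$ is Galois closed over $\mathbf{k}$ if $\overline{G}^{(k)}=G$. *)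

(* Defs.v *)
From mathcomp Require Import all_boot all_fingroup all_solvable.

Set Implicit Arguments.
Unset Strict Implicit.
Unset Printing Implicit Defensive.

Local Open Scope group_scope.

(* Conventions: the m-element set {1, ..., m} is 'I_m, an n-tuple over 'I_k is
   x : {ffun 'I_n -> 'I_k}, and permutations act on the right, i sigma being
   s i, as in MathComp: (s * t) i = t (s i). *)

(* The operations f : k^n -> k; a finite function, so that quantification over
   all of them is boolean and the closure below is a {set 'S_n}. *)
Definition operation (n k : nat) : finType :=
  {ffun {ffun 'I_n -> 'I_k} -> 'I_k}.

Definition leaves_invariant (n k : nat) (s : 'S_n) (f : operation n k) : bool :=
  [forall x : {ffun 'I_n -> 'I_k}, f x == f [ffun i => x (s i)]].

Definition galois_closure (n k : nat) (A : {set 'S_n}) : {set 'S_n} :=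
  [set s : 'S_n | [forall f : operation n k,
     [forall t in A, leaves_invariant t f] ==> leaves_invariant s f]].

Lemma galois_closure_group_set (n k : nat) (A : {set 'S_n}) :
  group_set (galois_closure k A).
Proof.
apply/group_setP; split=> [|s t].
  rewrite inE; apply/forallP=> f; apply/implyP=> _; apply/forallP=> x.
  by apply/eqP; congr (f _); apply/ffunP=> i; rewrite ffunE perm1.
rewrite !inE => /forallP Hs /forallP Ht; apply/forallP=> f; apply/implyP=> fA.
have /forallP fs := implyP (Hs f) fA; have /forallP ft := implyP (Ht f) fA.
apply/forallP=> x; rewrite (eqP (ft x)) (eqP (fs _)).
by apply/eqP; congr (f _); apply/ffunP=> i; rewrite !ffunE permM.
Qed.

Canonical galois_closure_group (n k : nat) (A : {set 'S_n}) : {group 'S_n} :=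
  Group (galois_closure_group_set k A).

Definition galois_closed (n k : nat) (G : {group 'S_n}) : bool :=
  galois_closure k G == G.

(* A_B inside S_n: the even permutations fixing every point outside B (parity
   on 'I_n and on B agree for permutations supported in B). *)
Definition alt_on (n : nat) (B : {set 'I_n}) : {set 'S_n} :=
  [set s in 'Alt_('I_n) | perm_on B s].

(* s is an m-cycle (for m > 1): one orbit of size m, every other point fixed. *)
Definition is_cycle_of_length (n m : nat) (s : 'S_n) : bool :=
  [exists x : 'I_n, (#|porbit s x| == m) && perm_on (porbit s x) s].

(* Main.v *)
(* A permutation s is in the closure of G iff for every colouring x there is g
   in G with x o s = x o g, i.e. the coset C = s^-1 G meets the stabiliser of x.
   Suppose s is in the closure but not in G.  Colourings identifying just two
   disjoint pairs {a,b} and {c,d} show that C contains (a b), (c d) or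
   (a b)(c d).  Since (x z) = (y z)(x y)(y z), the relation (x y) \in C is an
   equivalence.  If {a,b} and {c,d} have no link across, then (a c)(b d) and
   (a d)(b c) lie in C, so (a d)(b c)(a c)(b d) = (a b)(c d) is in G: then a ~ b
   and c ~ d.  Hence there are at most two classes, and sizes (>= 2, >= 3) are
   impossible.  One class gives G = A_n, sizes (n-1, 1) give G = A_B, and
   sizes (2, 2) give a group generated by a 4-cycle. *)
Require Import Defs.
From mathcomp Require Import all_boot all_fingroup all_solvable.

Local Open Scope group_scope.

(** * Four distinct points and their transpositions *)

Lemma uniq4 (T : eqType) (a b c d : T) :
  a != b -> a != c -> a != d -> b != c -> b != d -> c != d ->
  uniq [:: a; b; c; d].
Proof. by rewrite /= !inE !negb_or => -> -> -> -> -> ->. Qed.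

Lemma uniq4_neq {T : eqType} {a b c d : T} : uniq [:: a; b; c; d] ->
  ((a == b) = false) * ((a == c) = false) * ((a == d) = false) *
  ((b == c) = false) * ((b == d) = false) * ((c == d) = false) *
  ((b == a) = false) * ((c == a) = false) * ((d == a) = false) *
  ((c == b) = false) * ((d == b) = false) * ((d == c) = false).
Proof.
rewrite /= !inE !negb_or !andbT => /and3P[/and3P[ab ac ad] /andP[bc bd] cd].
by do !split; apply/negbTE; rewrite // eq_sym.
Qed.

Lemma tperm_mulK {T : finType} (x y : T) (g : {perm T}) :
  tperm x y * (tperm x y * g) = g.
Proof. by rewrite mulgA tperm2 mul1g. Qed.

(** The double transpositions on four points form, with 1, a Klein four-group, where the quotient of
    two is the third. *)
Lemma double_tperm_quotient {T : finType} (a b c d : T) :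
  uniq [:: a; b; c; d] ->
  (tperm a c * tperm b d)^-1 * (tperm a d * tperm b c) = tperm a b * tperm c d.
Proof.
move=> /uniq4_neq neq4; have neq := (eqxx, neq4).
rewrite invMg !tpermV; apply/permP => i; rewrite !permM !permE /=.
have [iE|ia] := eqVneq i a; first by rewrite ?iE; do 4 rewrite ?neq /=.
have [iE|ib] := eqVneq i b; first by rewrite ?iE; do 4 rewrite ?neq /=.
have [iE|ic] := eqVneq i c; first by rewrite ?iE; do 4 rewrite ?neq /=.
have [iE|id] := eqVneq i d; first by rewrite ?iE; do 4 rewrite ?neq /=.
by do 2 rewrite ?(negbTE ia, negbTE ib, negbTE ic, negbTE id) /=.
Qed.

Lemma perm_on_setT {T : finType} (g : {perm T}) : perm_on setT g.
Proof. by apply/subsetP => x; rewrite inE. Qed.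

(** * The graph of transpositions lying in the coset C *)

Section CosetGraph.

Context {T : finType} {G : {group {perm T}}} {s : {perm T}}.
Hypothesis sNG : s \notin G.

(* [s * c \in G] says that c lies in the coset C = s^-1 G. *)
Definition linked (x y : T) : bool := (x == y) || (s * tperm x y \in G).

Lemma coset_mulr {c g} : s * c \in G -> g \in G -> s * (c * g) \in G.
Proof. by rewrite mulgA; exact: groupM. Qed.

Lemma coset_mulVr {c d} : s * c \in G -> s * d \in G -> c^-1 * d \in G.
Proof.
move=> cC dC; have ->: c^-1 * d = (s * c)^-1 * (s * d).
  by rewrite invMg mulgA mulgKV.
by rewrite groupM ?groupV.
Qed.

(** C is a coset of G other than G itself, hence disjoint from G. *)
Lemma coset_notin {c} : s * c \in G -> c \notin G.
Proof. by move=> cC; apply: contra sNG => cG; rewrite -(groupMr s cG). Qed.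

Lemma linked_tperm x y : x != y -> linked x y = (s * tperm x y \in G).
Proof. by rewrite /linked => /negbTE ->. Qed.

Lemma linked_refl x : linked x x. Proof. by rewrite /linked eqxx. Qed.

Lemma linked_sym : symmetric linked.
Proof. by move=> x y; rewrite /linked eq_sym tpermC. Qed.

Lemma unlinked_neq {x y} : ~~ linked x y -> x != y.
Proof. by rewrite negb_or => /andP[]. Qed.

Lemma linked_trans {y x z} : linked x y -> linked y z -> linked x z.
Proof.
move=> xy yz; rewrite /linked; have [//|xz /=] := eqVneq x z.
have [xy_eq|xNy] := eqVneq x y.
  by rewrite xy_eq -linked_tperm -?xy_eq // xy_eq.
have [yz_eq|yNz] := eqVneq y z; first by rewrite -yz_eq -linked_tperm.
rewrite linked_tperm // in xy; rewrite linked_tperm // in yz.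
(* The middle factor is written as an inverse, so that the product has the form [c * (d^-1 * c)]
   with [c], [d] in C and [d^-1 * c] in G. *)
have ->: tperm x z = tperm y z * ((tperm x y)^-1 * tperm y z).
  rewrite tpermV -{1}[tperm y z]tpermV -/(conjg _ _) tpermJ tpermL.
  by rewrite tpermD // eq_sym.
by apply: coset_mulr => //; apply: coset_mulVr.
Qed.

Lemma unlinked_classes {a c} :
  ~~ linked a c -> forall x y, linked a x -> linked c y -> ~~ linked x y.
Proof.
move=> nac x y ax cy; apply: contra nac => xy.
apply: linked_trans ax (linked_trans xy _); by rewrite linked_sym.
Qed.

(** All transpositions on the clique [B] lie in C, so an even number of them multiply into G and an
    odd number into C. The induction, on the number of moved points, splits one transposition off
    [g]. *)
Lemma linked_perm_on {B : {set T}} {g} :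
  {in B &, forall x y, linked x y} -> perm_on B g ->
  if odd_perm g then s * g \in G else g \in G.
Proof.
move=> clB; have [n] := ubnP #|[pred x | g x != x]|; elim: n g => // n IHn g.
rewrite ltnS => le_gn gB.
have [x /= gx|g1] := pickP [pred x | g x != x]; last first.
  suff ->: g = 1 by rewrite odd_perm1 group1.
  by apply/permP => x; rewrite perm1; apply/eqP/negbNE/negbT/g1.
have xB: x \in B by apply: (subsetP gB).
have gxB: g x \in B by rewrite perm_closed.
have xC : s * tperm x (g x) \in G by rewrite -linked_tperm ?clB // eq_sym.
pose h := tperm x (g x) * g.
have gE: g = tperm x (g x) * h by rewrite tperm_mulK.
have hgx : h (g x) = g x by rewrite permM tpermR.
have hB : perm_on B h.
  apply: perm_onM => //; apply: subset_trans (tperm_on _ _) _.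
  by apply/subsetP => y; rewrite !inE => /orP[]/eqP->.
have odd_h : odd_perm g = ~~ odd_perm h.
  by rewrite {1}gE odd_permM odd_tperm eq_sym gx.
have: if odd_perm h then s * h \in G else h \in G.
  apply: IHn hB; apply: leq_trans le_gn; apply: proper_card.
  (* [h] fixes every fixed point of [g], and also [g x], which [g] moves. *)
  apply/properP; split; last first.
    by exists (g x); rewrite !inE ?hgx ?eqxx // inj_eq //; exact: perm_inj.
  apply/subsetP => y; rewrite !inE; apply: contra => /eqP gy.
  rewrite permM tpermD ?gy //; apply: contraNneq gx.
    by move=> ->; rewrite gy.
  by move=> gxy; rewrite -(inj_eq (@perm_inj _ g)) gxy gy.
rewrite odd_h; case: ifP => /= _ hG.
  by rewrite gE -(tpermV x) coset_mulVr.
by rewrite gE coset_mulr.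
Qed.

(** * Sizes of the classes, from the alternative that colourings provide for disjoint pairs *)

Hypothesis double_tperm : forall a b c d, uniq [:: a; b; c; d] ->
  [|| linked a b, linked c d | s * (tperm a b * tperm c d) \in G].

(** The alternative forces (a c)(b d) and (a d)(b c) into C, so their quotient (a b)(c d) is in G,
    hence not in C. One of the pairs {a,b}, {c,d} is therefore linked, and multiplying its
    transposition by that quotient links the other. *)
Lemma unlinked_cross {a b c d} :
    a != b -> c != d ->
    ~~ linked a c -> ~~ linked a d -> ~~ linked b c -> ~~ linked b d ->
  [/\ s * (tperm a c * tperm b d) \in G, s * (tperm a d * tperm b c) \in G
    & linked a b && linked c d].
Proof.
move=> ab cd nac nad nbc nbd.
have [ac ad bc bd] : [/\ a != c, a != d, b != c & b != d].
  by split; exact: unlinked_neq.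
have U : uniq [:: a; b; c; d] by exact: uniq4.
have acbd : s * (tperm a c * tperm b d) \in G.
  have := double_tperm a c b d; rewrite (negbTE nac) (negbTE nbd); apply.
  by rewrite uniq4 // eq_sym.
have adbc : s * (tperm a d * tperm b c) \in G.
  have := double_tperm a d b c; rewrite (negbTE nad) (negbTE nbc); apply.
  by rewrite uniq4 // eq_sym.
split=> //; have zG := coset_mulVr acbd adbc.
rewrite double_tperm_quotient // in zG.
have := double_tperm _ _ _ _ U; case/or3P => [abC|cdC|/coset_notin/negP//].
  rewrite abC linked_tperm //.
  rewrite linked_tperm // in abC.
  by have := coset_mulr abC zG; rewrite tperm_mulK.
rewrite cdC linked_tperm // andbT.
rewrite linked_tperm // in cdC.
have := coset_mulr cdC zG.
suff ->: tperm c d * (tperm a b * tperm c d) = tperm a b by [].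
by rewrite -{1}[tperm c d]tpermV -/(conjg _ _) tpermJ !tpermD // eq_sym.
Qed.

(** A fourth point lies in at most one of the three classes. Paired with the representative of its
    class, or with [c] if it lies in none, it faces two unlinked points, which [unlinked_cross]
    would link. *)
Lemma no_three_classes {a b c} :
  3 < #|T| -> ~~ linked a b -> ~~ linked a c -> ~~ linked b c -> False.
Proof.
move=> T4 nab nac nbc.
have cross u v w d : d != w -> ~~ linked u v -> ~~ linked u w ->
    ~~ linked v w -> ~~ linked u d -> ~~ linked v d -> False.
  rewrite eq_sym => wd nuv nuw nvw nud nvd.
  have [_ _] := unlinked_cross (unlinked_neq nuv) wd nuw nud nvw nvd.
  by rewrite (negbTE nuv).
have /subsetPn[d _] : ~~ ([set: T] \subset [:: a; b; c]).
  apply: contraL T4 => /subset_leq_card; rewrite cardsT -leqNgt.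
  by move=> /leq_trans; apply; exact: card_size.
rewrite !inE !negb_or => /and3P[da db dc].
have unlk u v : ~~ linked u v -> linked u d -> ~~ linked v d.
  by move=> nuv ud; rewrite linked_sym (unlinked_classes nuv) ?linked_refl.
have [ad|nad] := boolP (linked a d).
  by apply: (cross b c a d); rewrite // ?(linked_sym _ a) //; apply: unlk ad.
have [bd|nbd] := boolP (linked b d).
  by apply: (cross a c b d); rewrite // ?(linked_sym _ b) //; apply: unlk bd.
exact: (cross a b c d).
Qed.

(** Otherwise (a c)(b d) and (a c)(b e) lie in C and their quotient (b d)(b e) in G; multiplying (d
    e) from C by it gives (b d), which links [b] with [d]. *)
Lemma no_class_2_3 {a b c d e} :
    a != b -> c != d -> c != e -> d != e ->
    linked a b -> linked c d -> linked d e ->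
  linked a c.
Proof.
move=> ab cd ce de Lab Lcd Lde; apply: contraT => nac.
have unlk := unlinked_classes nac.
have Lce := linked_trans Lcd Lde.
have nad := unlk _ _ (linked_refl a) Lcd.
have nae := unlk _ _ (linked_refl a) Lce.
have nbc := unlk _ _ Lab (linked_refl c); have nbd := unlk _ _ Lab Lcd.
have nbe := unlk _ _ Lab Lce.
have [acbd _ _] := unlinked_cross ab cd nac nad nbc nbd.
have [acbe _ _] := unlinked_cross ab ce nac nae nbc nbe.
have := coset_mulVr acbd acbe; rewrite invMg !tpermV -mulgA tperm_mulK.
rewrite linked_tperm // in Lde => /(coset_mulr Lde).
suff ->: tperm d e * (tperm b d * tperm b e) = tperm b d.
  by rewrite -linked_tperm ?(negbTE nbd) // unlinked_neq.
have ->: tperm b e = tperm d e ^ tperm b d.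
  by rewrite tpermJ tpermR tpermD // ?unlinked_neq // eq_sym.
by rewrite /conjg tpermV !tperm_mulK.
Qed.

(** If [g] moves [p], pick [u], [v] outside {p, g p}. The preimages of [p], [u], [v] under [g] avoid
    [p], so they are linked; conjugating a quotient of their transpositions by [g] puts (u v)(p u)
    in G, and then (p u) is in C. *)
Lemma isolated_fixed {p g} :
    3 < #|T| -> (forall x, x != p -> ~~ linked p x) ->
    (forall x y, x != p -> y != p -> linked x y) -> g \in G ->
  g p = p.
Proof.
move=> T4 isoP clP gG; apply/eqP/contraT => gp.
have /card_gt1P[u [v [uP vP uv]]] : 1 < #|~: [set p; g p]|.
  by rewrite -(ltn_add2l #|[set p; g p]|) cardsC cards2 eq_sym gp.
move: uP vP; rewrite !inE !negb_or => /andP[up ugp] /andP[vp vgp].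
have gVp x : (g^-1 x != p) = (x != g p).
  by rewrite -(inj_eq (@perm_inj _ g)) permKV.
have inj := inj_eq (@perm_inj _ g^-1).
have quC : s * tperm (g^-1 p) (g^-1 u) \in G.
  by rewrite -linked_tperm ?clP ?gVp // ?inj // eq_sym.
have uvC' : s * tperm (g^-1 u) (g^-1 v) \in G.
  by rewrite -linked_tperm ?clP ?gVp // inj.
have uvC : s * tperm u v \in G by rewrite -linked_tperm ?clP.
have := groupVr (groupJ (coset_mulVr quC uvC') gG).
rewrite conjMg conjVg !tpermJ !permKV invMg !tpermV => /(coset_mulr uvC).
by rewrite tperm_mulK -linked_tperm ?(negbTE (isoP _ up)) // eq_sym.
Qed.

Lemma two_pairs_cyclic {a b c d} :
    a != b -> c != d -> linked a b -> linked c d -> ~~ linked a c ->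
    (forall x, x \in [:: a; b; c; d]) ->
  exists t, [/\ porbit t a = [set: T], #[t] = 4 & G :=: <[t]>].
Proof.
move=> ab cd Lab Lcd nac allT.
have unlk := unlinked_classes nac.
have nad := unlk _ _ (linked_refl a) Lcd.
have nbc := unlk _ _ Lab (linked_refl c); have nbd := unlk _ _ Lab Lcd.
have [acbd adbc _] := unlinked_cross ab cd nac nad nbc nbd.
have [ac ad bc bd] : [/\ a != c, a != d, b != c & b != d].
  by split; exact: unlinked_neq.
have U : uniq [:: a; b; c; d] by exact: uniq4.
have zG : tperm a b * tperm c d \in G.
  by rewrite -double_tperm_quotient //; exact: coset_mulVr.
have abC : s * tperm a b \in G by rewrite -linked_tperm.
have cdC : s * tperm c d \in G by rewrite -linked_tperm.
(* The 4-cycle sending [a] to [d], [d] to [b], [b] to [c] and [c] to [a]; it is a quotient of two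
   elements of C. *)
pose t := tperm a b * (tperm a c * tperm b d).
have tG : t \in G by rewrite /t -{1}[tperm a b]tpermV coset_mulVr.
have ta : t a = d by rewrite !permM tpermL (tpermD ab) 1?eq_sym // tpermL.
have td : t d = b by rewrite !permM (tpermD ad bd) (tpermD ad cd) tpermR.
have tb : t b = c by rewrite !permM tpermR tpermL tpermD // eq_sym.
have tc : t c = a by rewrite !permM (tpermD ac bc) tpermR tpermD // eq_sym.
clearbody t.
have t_orbit x : exists i, (t ^+ i) a = x.
  have := allT x; rewrite !inE => /or4P[] /eqP->.
  - by exists 0; rewrite expg0 perm1.
  - by exists 2; rewrite !expgS expg0 mulg1 !permM ta td.
  - by exists 3; rewrite !expgS expg0 mulg1 !permM ta td tb.
  - by exists 1%N; rewrite expg1.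
have t4 : t ^+ 4 = 1.
  apply/permP => x; rewrite !expgS expg0 mulg1 !permM perm1.
  by have := allT x; rewrite !inE => /or4P[] /eqP->; rewrite !(ta, tb, tc, td).
exists t; split.
- by apply/setP => x; rewrite inE; have [i <-] := t_orbit x; exact: mem_porbit.
- have : #[t] %| 4 by rewrite order_dvdn t4.
  have : ~~ (#[t] %| 2).
    rewrite order_dvdn; apply: contra_neqN ab => /eqP/permP/(_ a).
    by rewrite permM ta td perm1.
  by case: #[t] => [|[|[|[|[|m]]]]] // _ /dvdn_leq.
(* Since the powers of [t] act transitively, it suffices that an element [h] of G fixing [a] is
   trivial. *)
apply/eqP; rewrite eqEsubset cycle_subG tG andbT; apply/subsetP => g gG.
have [i tia] := t_orbit (g a).
pose h := g * (t ^+ i)^-1.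
have hG : h \in G by rewrite groupM ?groupV ?groupX.
have ha : h a = a by rewrite permM -tia permK.
suff h1 : h = 1 by rewrite -[g](mulgKV (t ^+ i)) -/h h1 mul1g mem_cycle.
have inj := inj_eq (@perm_inj _ h).
have := groupJ zG hG; rewrite conjMg !tpermJ ha => zhG.
have hx x : x != a -> [|| h x == b, h x == c | h x == d].
  by rewrite -inj ha => /negbTE hxa; have := allT (h x); rewrite !inE hxa.
have [ba ca da] : [/\ b != a, c != a & d != a] by split; rewrite eq_sym.
have hN x y z : x != y -> h x = z -> h y != z.
  by move=> xy <-; rewrite inj eq_sym.
(* If [h] moved [b], conjugating (a b)(c d) by [h] would put (a c)(b d) or (a d)(b c) in G, but both
   lie in C. *)
have hb : h b = b.
  have /or3P[/eqP//|/eqP hbE|/eqP hbE] := hx b ba; exfalso; rewrite hbE in zhG.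
    have /negbTE hc := hN _ _ _ bc hbE; have /negbTE hd := hN _ _ _ bd hbE.
    have := hx c ca; have := hx d da; rewrite hc hd /=.
    move=> /orP[]/eqP hdE /orP[]/eqP hcE.
    - by move: cd; rewrite -inj hcE hdE eqxx.
    - by case/negP: (coset_notin acbd); rewrite (tpermC b) -hcE -hdE.
    - by case/negP: (coset_notin acbd); rewrite -hcE -hdE.
    - by move: cd; rewrite -inj hcE hdE eqxx.
  have /negbTE hc := hN _ _ _ bc hbE; have /negbTE hd := hN _ _ _ bd hbE.
  have := hx c ca; have := hx d da; rewrite hc hd !orbF.
  move=> /orP[]/eqP hdE /orP[]/eqP hcE.
  - by move: cd; rewrite -inj hcE hdE eqxx.
  - by case/negP: (coset_notin adbc); rewrite (tpermC b) -hcE -hdE.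
  - by case/negP: (coset_notin adbc); rewrite -hdE -hcE.
  - by move: cd; rewrite -inj hcE hdE eqxx.
(* Fixing [a] and [b] but moving [c], [h] would be (c d), an element of C. *)
have hc : h c = c.
  have := hx c ca; rewrite (negbTE (hN _ _ _ bc hb)) /= => /orP[]/eqP // hcE.
  case/negP: (coset_notin cdC); suff <- : h = tperm c d by [].
  have hd : h d = c.
    have := hx d da; rewrite (negbTE (hN _ _ _ bd hb)).
    by rewrite (negbTE (hN _ _ _ cd hcE)) orbF => /eqP.
  apply/permP => x; have := allT x; rewrite !inE => /or4P[] /eqP->;
    by rewrite ?(ha, hb, hcE, hd, tpermL, tpermR) ?tpermD // eq_sym.
have hd : h d = d.
  have := hx d da; rewrite (negbTE (hN _ _ _ bd hb)).
  by rewrite (negbTE (hN _ _ _ cd hc)) => /eqP.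
apply/permP => x; rewrite perm1.
by have := allT x; rewrite !inE => /or4P[] /eqP->.
Qed.

End CosetGraph.

(** * The closure in terms of colourings *)

Lemma galois_closureP {n k : nat} {G : {group 'S_n}} {s : 'S_n} : 1 < k ->
  reflect (forall x : {ffun 'I_n -> 'I_k},
             exists2 g, g \in G & forall i, x (s i) = x (g i))
          (s \in galois_closure k G).
Proof.
move=> k1; rewrite inE; apply: (iffP forallP) => [sG x|sG f].
  (* The test operation [f] is the indicator of the orbit of [x] under G, with the two colours 1 and
     0. *)
  pose orb (y : {ffun 'I_n -> 'I_k}) :=
    [exists g in G, [forall i, y i == x ((g : 'S_n) i)]].
  pose f : operation n k :=
    [ffun y => if orb y then Ordinal k1 else Ordinal (ltnW k1)].
  have fG : [forall t in G, leaves_invariant t f].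
    apply/forall_inP => t tG; apply/forallP => y; apply/eqP; rewrite !ffunE.
    congr (if _ then _ else _).
    apply/exists_inP/exists_inP => -[g gG /forallP yg].
      exists (t * g); rewrite ?groupM //.
      by apply/forallP => i; rewrite ffunE permM.
    exists (t^-1 * g); rewrite ?groupM ?groupV //; apply/forallP => i.
    by have := yg (t^-1 i); rewrite ffunE permM permKV.
  have /forallP/(_ x) := implyP (sG f) fG; rewrite !ffunE.
  have -> : orb x.
    apply/exists_inP; exists 1; rewrite ?group1 //.
    by apply/forallP => i; rewrite perm1.
  case: ifP => // /exists_inP[g gG /forallP xg] _.
  by exists g => // i; have := xg i; rewrite ffunE => /eqP.
(* Conversely, an operation invariant under G does not distinguish [x] from its composite with [g],
   which is also its composite with [s]. *)
apply/implyP => /forall_inP fG; apply/forallP => x; have [g gG xg] := sG x.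
have /forallP/(_ x)/eqP -> := fG g gG.
by apply/eqP; congr (f _); apply/ffunP => i; rewrite !ffunE xg.
Qed.

Lemma sub_galois_closure {n : nat} (k : nat) (A : {set 'S_n}) :
  A \subset galois_closure k A.
Proof.
apply/subsetP => t tA; rewrite inE; apply/forallP => f.
by apply/implyP => /forall_inP/(_ t tA).
Qed.

(** A colouring whose only coincidences are within {a,b} and {c,d} uses exactly n-2 colours, and its
    stabiliser only permutes points within these pairs. *)
Lemma two_pairs_colouring {n : nat} {a b c d : 'I_n} : uniq [:: a; b; c; d] ->
  exists x : {ffun 'I_n -> 'I_(n - 2)}, forall t : 'S_n,
    (forall i, x (t i) = x i) ->
  t \in [:: 1; tperm a b; tperm c d; tperm a b * tperm c d].
Proof.
move=> U; have neq4 := uniq4_neq U; have neq := (eqxx, neq4); move: U.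
rewrite /= !inE !negb_or !andbT => /and3P[/and3P[ab ac ad] /andP[bc bd] cd].
(* Colour every point by its image under b |-> a, d |-> c. *)
pose S := ~: [set b; d].
have cardS : #|S| = (n - 2)%N by rewrite cardsCs setCK cards2 bd card_ord.
have aS : a \in S by rewrite !inE negb_or ab ad.
pose r i := if i == b then a else if i == d then c else i.
have rS i : r i \in S.
  rewrite /r; case: eqVneq => [_ //|ib]; case: eqVneq => [_|id].
    by rewrite !inE negb_or cd eq_sym bc.
  by rewrite !inE negb_or ib.
(* Numbering [S] turns [r] into a colouring; [aS] only witnesses that [S] is nonempty, and the ranks
   are faithful because [r] takes values in [S]. *)
exists [ffun i => cast_ord cardS (enum_rank_in aS (r i))] => t xt.
have {xt} rt i : r (t i) = r i.
  by have := xt i; rewrite !ffunE => /cast_ord_inj; apply: enum_rank_in_inj.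
have [ra rb rc rd] : [/\ r a = a, r b = a, r c = c & r d = c].
  by rewrite /r !neq.
have rE i : i != b -> i != d -> r i = i by rewrite /r => /negbTE-> /negbTE->.
have r_a i : r i = a -> i = a \/ i = b.
  rewrite /r; case: (eqVneq i b) => [|_]; first by right.
  by case: eqVneq => [_ /eqP|_]; [rewrite neq | left].
have r_c i : r i = c -> i = c \/ i = d.
  rewrite /r; case: (eqVneq i b) => [_ /eqP|_]; first by rewrite neq.
  by case: eqVneq => [|_]; [right | left].
have inj := @perm_inj _ t.
have tab : (t a = a /\ t b = b) \/ (t a = b /\ t b = a).
  have := r_a _ (etrans (rt a) ra); have := r_a _ (etrans (rt b) rb).
  move=> [] tb [] ta; [|by right|by left|];
    by move/eqP: ab; case; apply: inj; rewrite ta.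
have tcd : (t c = c /\ t d = d) \/ (t c = d /\ t d = c).
  have := r_c _ (etrans (rt c) rc); have := r_c _ (etrans (rt d) rd).
  move=> [] td [] tc; [|by right|by left|];
    by move/eqP: cd; case; apply: inj; rewrite tc.
have t_out i : i != a -> i != b -> i != c -> i != d -> t i = i.
  move=> ia ib ic id; have := rt i; rewrite (rE i) // {1}/r.
  case: eqVneq => [_ iE|_]; first by rewrite iE eqxx in ia.
  by case: eqVneq => [_ iE|//]; rewrite iE eqxx in ic.
have tE (u : {perm 'I_n}) : u a = t a -> u b = t b -> u c = t c -> u d = t d ->
  (forall i, i != a -> i != b -> i != c -> i != d -> u i = i) -> t = u.
  move=> ua ub uc ud uout; apply/permP => i.
  have [->//|ia] := eqVneq i a; have [->//|ib] := eqVneq i b.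
  have [->//|ic] := eqVneq i c; have [->//|id] := eqVneq i d.
  by rewrite t_out ?uout.
rewrite !inE; apply/or4P.
case: tab => -[ta tb]; case: tcd => -[tc td].
- apply: Or41; apply/eqP/tE; rewrite ?perm1 //.
  by move=> i *; rewrite perm1.
- apply: Or43; apply/eqP/tE; rewrite ?tpermL ?tpermR ?tpermD ?neq4 //.
  by move=> i *; rewrite tpermD // eq_sym.
- apply: Or42; apply/eqP/tE; rewrite ?tpermL ?tpermR ?tpermD ?neq4 //.
  by move=> i *; rewrite tpermD // eq_sym.
apply: Or44; apply/eqP/tE; rewrite ?permM ?tpermL ?tpermR
  ?[tperm a b _]tpermD ?tpermL ?tpermR ?tpermD ?neq4 //.
by move=> i *; rewrite permM !tpermD // eq_sym.
Qed.

(** * The exceptional groups are not Galois closed *)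

Lemma alt_on_not_galois_closed {n : nat} (k : nat) (B : {set 'I_n})
    (G : {group 'S_n}) :
  1 < k -> k < #|B| -> G :=: alt_on B -> ~~ galois_closed k G.
Proof.
move=> k1 kB GE; have /card_gt1P[u [v [uB vB uv]]] := ltn_trans k1 kB.
have tB x y : x \in B -> y \in B -> perm_on B (tperm x y).
  move=> xB yB; apply: subset_trans (tperm_on _ _) _.
  by apply/subsetP => z; rewrite !inE => /orP[]/eqP->.
have uvG : tperm u v \notin G by rewrite GE inE Alt_even odd_tperm uv.
apply: contra uvG => /eqP <-; apply/galois_closureP => // x.
(* [B] has more points than there are colours, so some distinct [i], [j] in [B] share one; then [x]
   cannot tell the odd (u v) from the even (u v)(i j). *)
have /dinjectivePn[i iB [j]] : ~~ dinjectiveb x B.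
  by apply/dinjectiveP => /leq_card_in; rewrite leqNgt card_ord kB.
rewrite inE => /andP[ji jB] xij; exists (tperm u v * tperm i j).
  rewrite GE inE Alt_even odd_permM !odd_tperm uv eq_sym ji /=.
  by rewrite perm_onM ?tB.
by move=> h; rewrite permM; case: (tpermP i j) => [->|->|].
Qed.

(** G is the rotation group of a square. The reflection [r] in a diagonal is not a rotation, yet on
    each two-colouring it has the same effect as some rotation. *)
Lemma four_cycle_not_galois_closed (s : 'S_4) (G : {group 'S_4}) :
  is_cycle_of_length 4 s -> G :=: <[s]> -> ~~ galois_closed 2 G.
Proof.
case/existsP => p0 /andP[/eqP ps4 _] GE.
have sG : s \in G by rewrite GE cycle_id.
have := uniq_traject_porbit s p0; have := iter_porbit s p0; rewrite ps4 /=.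
set p1 := s p0; set p2 := s p1; set p3 := s p2 => sp3 U.
have allp i : i \in [:: p0; p1; p2; p3].
  have : porbit s p0 = [set: 'I_4].
    by apply/eqP; rewrite eqEcard subsetT cardsT card_ord ps4.
  by move/setP/(_ i); rewrite inE porbit_traject ps4 => ->.
move: U; rewrite /= !inE !negb_or !andbT.
move=> /and3P[/and3P[p01 p02 p03] /andP[p12 p13] p23].
pose r := tperm p0 p2.
have rp : [/\ r p0 = p2, r p1 = p1, r p2 = p0 & r p3 = p3].
  by rewrite /r tpermL tpermR !tpermD // eq_sym.
have [rp0 rp1 rp2 rp3] := rp.
have rNG : r \notin G.
  (* Powers of [s] commute with [s], whereas [s * r] and [r * s] send [p1] to [p0] and [p2]
     respectively. *)
  apply/negP; rewrite GE => /cycleP[i rE].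
  have := congr1 (fun t : 'S_4 => t p1) (commuteX i (commute_refl s)).
  by rewrite /= -rE !permM rp1 rp2 -/p2 => /eqP; rewrite (negbTE p02).
apply: contra rNG => /eqP <-; apply/galois_closureP => // x.
have I2 (u v w : 'I_2) : u != v -> u != w -> v = w.
  case: u v w => [[|[|//]] ?] [[|[|//]] ?] [[|[|//]] ?] // _ _;
    exact: val_inj.
have byp g : x p2 = x (g p0) -> x p1 = x (g p1) -> x p0 = x (g p2) ->
    x p3 = x (g p3) -> forall i, x (r i) = x (g i).
  by move=> ? ? ? ? i; have := allp i; rewrite !inE => /or4P[]/eqP->;
     rewrite ?rp0 ?rp1 ?rp2 ?rp3.
(* Equal colours on [p0], [p2] allow the identity, and on [p1], [p3] the half turn. Otherwise
   opposite corners differ, and a quarter turn works, in a direction decided by whether [p0] and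
   [p1] agree. *)
have [x02|x02] := eqVneq (x p0) (x p2).
  by exists 1; rewrite ?group1 //; apply: byp; rewrite perm1.
have [x13|x13] := eqVneq (x p1) (x p3).
  exists (s * s); first by rewrite groupM.
  by apply: byp; rewrite permM ?sp3.
have [x01|x01] := eqVneq (x p0) (x p1).
  have x23 : x p2 = x p3 by apply: (I2 (x p0)) => //; rewrite x01.
  exists s^-1; first by rewrite groupV.
  have [s0 s1 s2 s3] :
      [/\ s^-1 p0 = p3, s^-1 p1 = p0, s^-1 p2 = p1 & s^-1 p3 = p2].
    by split; apply: (@perm_inj _ s); rewrite permKV.
  by apply: byp; rewrite ?s0 ?s1 ?s2 ?s3.
have x12 : x p1 = x p2 by apply: (I2 (x p0)).
have x03 : x p0 = x p3 by apply: (I2 (x p1)); rewrite // eq_sym.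
by exists s => //; apply: byp; rewrite ?sp3.
Qed.

(** * Classification of the groups that are not Galois closed *)

Theorem proposition5p1 (n k : nat) (k_eq : k = (n - 2)%N) (k_ge2 : (2 <= k)%N)
    (G : {group 'S_n}) :
  ~~ galois_closed k G <->
  [\/ G :=: 'Alt_('I_n),
      (exists2 B : {set 'I_n}, #|B| = (n - 1)%N & G :=: alt_on B)
    | [/\ n = 4, #|G| = 4 &
          exists2 s : 'S_n, is_cycle_of_length 4 s & G :=: <[s]>]].
Proof.
subst k; have n4 : 3 < n by rewrite ltn_subRL in k_ge2.
have T4 : 3 < #|'I_n| by rewrite card_ord.
split; last first.
  case=> [GE|[B cardB GE]|[n_eq _ [s s4 GE]]].
  - apply: (@alt_on_not_galois_closed _ _ setT) => //.
      by rewrite cardsT card_ord ltn_subrL (ltn_trans _ n4).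
    by apply/setP => t; rewrite GE [in RHS]inE perm_on_setT andbT.
  - apply: alt_on_not_galois_closed GE => //.
    by rewrite cardB ltn_sub2l // (ltn_trans _ n4).
  - by subst n; exact: four_cycle_not_galois_closed GE.
rewrite /galois_closed eqEsubset sub_galois_closure andbT.
move=> /subsetPn[s sbar sNG]; pose L := @linked _ G s.
have double a b c d : uniq [:: a; b; c; d] ->
    [|| L a b, L c d | s * (tperm a b * tperm c d) \in G].
  case/two_pairs_colouring => x xP.
  (* The element [s^-1 * g] of C preserves [x], hence is one of four; it is not 1, as [s] is outside
     G. *)
  have [g gG xg] := galois_closureP k_ge2 sbar x.
  have sC : s * (s^-1 * g) \in G by rewrite mulKVg.
  have : s^-1 * g \in [:: 1; tperm a b; tperm c d; tperm a b * tperm c d].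
    by apply: xP => i; rewrite permM -xg permKV.
  rewrite !inE /L /linked => /or4P[] /eqP E; rewrite E in sC.
  - by rewrite mulg1 (negbTE sNG) in sC.
  - by rewrite sC orbT.
  - by rewrite sC !orbT.
  - by rewrite sC !orbT.
have mem_clique (B : {set 'I_n}) g :
    {in B &, forall x y, L x y} -> perm_on B g -> (g \in G) = ~~ odd_perm g.
  move=> clB /(linked_perm_on clB); case: ifP => _ // gC.
  by apply/negbTE; exact: coset_notin gC.
have L_sym : symmetric L by exact: linked_sym.
(* If all points are linked, the whole set is a clique and G is A_n; otherwise [p] and [q] represent
   the only two classes. *)
have [[p q] /= npq|allL] := pickP [pred pq | ~~ L pq.1 pq.2]; last first.
  apply: Or31; apply/setP => g; rewrite Alt_even (mem_clique setT) //.
    by move=> x y _ _; apply/negbNE/negbT; exact: (allL (x, y)).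
  exact: perm_on_setT.
have near_pq x : L p x \/ L q x.
  have [px|npx] := boolP (L p x); first by left.
  have [qx|nqx] := boolP (L q x); first by right.
  by case: (no_three_classes sNG double T4 npq npx nqx).
(* If {p'} is a class, the other points form a clique, which decides membership in G for
   permutations fixing [p']; [isolated_fixed] shows that G has no others. *)
have isolated p' q' : (forall x, L p' x \/ L q' x) ->
    (forall x, x != p' -> ~~ L p' x) ->
  exists2 B : {set 'I_n}, #|B| = (n - 1)%N & G :=: alt_on B.
  move=> near iso.
  have Lq x : x != p' -> L q' x by case: (near x) => // px /iso; rewrite px.
  have cl x y : x != p' -> y != p' -> L x y.
    by move=> /Lq qx /Lq; apply: linked_trans; rewrite [linked _ _]L_sym.
  exists [set~ p']; first by rewrite cardsC1 card_ord subn1.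
  apply/setP => g; rewrite inE Alt_even.
  have [gB|gNB] := boolP (perm_on _ g).
    by rewrite (mem_clique [set~ p']) ?andbT // => x y; rewrite !inE; exact: cl.
  rewrite andbF; apply: contraNF gNB => gG; apply/subsetP => x; rewrite !inE.
  apply: contraNneq => ->; apply/eqP; exact: (isolated_fixed T4 iso cl gG).
have [a /= /andP[ap pa]|iso_p] := pickP [pred x | (x != p) && L p x];
  last first.
  apply: Or32; apply: (isolated p q) => // x xp.
  by have /= := iso_p x; rewrite xp => /= ->.
have [b /= /andP[bq qb]|iso_q] := pickP [pred x | (x != q) && L q x];
  last first.
  apply: Or32; apply: (isolated q p).
    by move=> x; case: (near_pq x); [right | left].
  by move=> x xq; have /= := iso_q x; rewrite xq => /= ->.
have [pNa qNb] : p != a /\ q != b by rewrite eq_sym ap eq_sym.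
(* Both classes now have at least two points, so a fifth point would make a class of three beside
   one of two. *)
have all4 x : x \in [:: p; a; q; b].
  apply: contraT; rewrite !inE !negb_or => /and4P[xp xa xq xb].
  have [px|qx] := near_pq x; case/negP: npq.
    rewrite L_sym; apply: (no_class_2_3 sNG double (b := b) (d := a) (e := x));
      rewrite // 1?eq_sym //.
    by apply: linked_trans px; rewrite [linked _ _]L_sym.
  apply: (no_class_2_3 sNG double (b := a) (d := b) (e := x));
    rewrite // 1?eq_sym //.
  by apply: linked_trans qx; rewrite [linked _ _]L_sym.
have n_eq : n = 4.
  apply/eqP; rewrite eqn_leq n4 andbT -[leqLHS]card_ord -cardsT.
  apply: leq_trans (card_size [:: p; a; q; b]).
  by apply/subset_leq_card/subsetP => x _; exact: all4.
have [t [pt t4 GE]] := two_pairs_cyclic sNG double pNa qNb pa qb npq all4.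
apply: Or33; split=> //; first by rewrite GE -orderE.
exists t => //; apply/existsP; exists p.
by rewrite pt cardsT card_ord perm_on_setT andbT; apply/eqP.
Qed.
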